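(* Let $l\geq 2$ be an integer and let $n$ be a positive integer such that $n\equiv -1 \pmod{2^l}$. Then the function $\mathbb{F}_{5^n}\to\mathbb{F}_{5^n}$, $x\mapsto x^d$, is APN over $\mathbb{F}_{5^n}$ for $$d=\frac{1}{2}\cdot\frac{5^{n+1}-1}{5^{\frac{n+1}{2^l}}+1}+\frac{5^n-1}{4}.$$
   Context: Let $q=p^n$ with $p$ a prime number and $n$ a positive integer, and let $\mathbb{F}_q$ be the finite field with $q$ elements. For $f:\mathbb{F}_q\to\mathbb{F}_q$ and $a,b\in\mathbb{F}_q$, let $N_f(a,b)$ denote the number of solutions $x\in\mathbb{F}_q$ of the equation $f(x+a)-f(x)=b$. The function $f$ is called APN (almost perfectly nonlinear) if $\Delta_f:=\max\{N_f(a,b) : a,b\in\mathbb{F}_q,\ a\neq 0\}=2$ (the maximum is exactly $2$). *)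

(* Defs.v *)
From mathcomp Require Import all_boot all_order all_algebra.

Set Implicit Arguments.
Unset Strict Implicit.
Unset Printing Implicit Defensive.

Import GRing.Theory.

Local Open Scope ring_scope.

Definition diff_count (F : finFieldType) (f : F -> F) (a b : F) : nat :=
  #|[set x : F | f (x + a) - f x == b]|.

Definition diff_uniformity (F : finFieldType) (f : F -> F) : nat :=
  \max_(a : F | a != 0) \max_(b : F) diff_count f a b.

Definition APN (F : finFieldType) (f : F -> F) : Prop :=
  diff_uniformity f = 2%N.

(* The truncated divisions in the exponent are exact when
   2 ^ l %| n.+1 and 0 < l, by the following lemma. *)
Lemma exponent_divisions_exact (l n : nat) (hl : (0 < l)%N)
  (hn : (2 ^ l %| n.+1)%N) :
  [/\ (5 ^ ((n + 1) %/ 2 ^ l) + 1 %| 5 ^ (n + 1) - 1)%N,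
      (2 %| (5 ^ (n + 1) - 1) %/ (5 ^ ((n + 1) %/ 2 ^ l) + 1))%N
    & (4 %| 5 ^ n - 1)%N].
Proof.
have pow1 x k : (0 < x)%N -> (x - 1 %| x ^ k - 1)%N.
  move=> x0; rewrite -eqn_mod_dvd ?expn_gt0 ?x0 // -modnXm.
  have /eqP -> : (x == 1 %[mod x - 1])%N by rewrite eqn_mod_dvd.
  by rewrite modnXm exp1n.
have h4 k : (4 %| 5 ^ k - 1)%N by exact: (pow1 5).
rewrite !addn1; set m := (n.+1 %/ 2 ^ l)%N.
have -> : (n.+1 = m * 2 * 2 ^ l.-1)%N by rewrite -mulnA -expnS prednK // divnK.
have [s hs] : exists s, (5 ^ (m * 2 * 2 ^ l.-1) - 1 = s * (5 ^ (m * 2) - 1))%N.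
  by apply/dvdnP; rewrite (expnM 5 (m * 2)); apply: pow1; rewrite expn_gt0.
have hd : (5 ^ (m * 2 * 2 ^ l.-1) - 1 = s * (5 ^ m - 1) * (5 ^ m).+1)%N.
  by rewrite hs (expnM 5 m) -[X in (_ - X)%N](exp1n 2) subn_sqr addn1 mulnA.
split => //; first by rewrite hd dvdn_mull.
by rewrite hd mulnK // dvdn_mull // (@dvdn_trans 4).
Qed.

(* Main.v *)
Require Import Defs.
From mathcomp Require Import all_boot all_order all_algebra.
From mathcomp Require Import all_field ring zify.

Set Implicit Arguments.
Unset Strict Implicit.
Unset Printing Implicit Defensive.

Import GRing.Theory.

Local Open Scope ring_scope.

(** With k := m or m + n, whichever is odd, where m := (n + 1) / 2 ^ l, the power
    map x ^ d is a permutation of F with inverse g : y |-> y ^ ((5 ^ k + 1) / 2),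
    and a permutation is APN as soon as its inverse is, since
    f (x + a) - f x = b is equivalent to g (u + b) - g u = a for u = f x.
    Rescaling b to 2, one studies g (y + 1) - g (y - 1).  Writing
    2 y = t + 1/t with t in the field of order 25 ^ n, this difference is
    a constant multiple of w + 1/w where w = t ^ ((5 ^ k - 1) / 2), so it
    determines w up to inversion.  As gcd (5 ^ k - 1, 25 ^ n - 1) = 4 and
    (5 ^ k - 1) / 2 = 2 modulo 4, w determines t up to sign, so the difference
    determines y up to sign. *)

Lemma addrV_inj (K : fieldType) (w z : K) : w != 0 -> z != 0 ->
  w + w^-1 = z + z^-1 -> w = z \/ w = z^-1.
Proof.
move=> w0 z0 e.
have : (w - z) * (w * z - 1) = 0.
  have -> : (w - z) * (w * z - 1) = w * z * ((w + w^-1) - (z + z^-1)).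
    by field; rewrite w0 z0.
  by rewrite e subrr mulr0.
move/eqP; rewrite mulf_eq0 !subr_eq0 => /orP[/eqP|/eqP wz]; first by left.
by right; rewrite -[LHS](mulfK z0) wz mul1r.
Qed.

Lemma expr_fix_iter (R : pzSemiRingType) (x : R) (q j : nat) :
  x ^+ q = x -> x ^+ (q ^ j) = x.
Proof. by move=> xq; elim: j => [|j IH]; rewrite ?expr1 // expnS exprM xq. Qed.

(** Bezout gives [u * j = v * k + 1], so x = x^(p^(uj)) = (x^(p^(vk)))^p = x^p. *)
Lemma expr_fix_coprime (R : pzSemiRingType) (x : R) (p j k : nat) : (0 < j)%N ->
  coprime j k -> x ^+ (p ^ j) = x -> x ^+ (p ^ k) = x -> x ^+ p = x.
Proof.
move=> j0 /eqP cjk xj xk; case: (egcdnP k j0) => u v; rewrite cjk => uv _.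
have := expr_fix_iter u xj.
by rewrite -expnM mulnC uv expnD expn1 exprM mulnC expnM (expr_fix_iter _ xk).
Qed.

Section Joukowski.

Variables (K : fieldType) (y t : K).
(** Denominator-free form of 2y = t + 1/t; it already forces t to be nonzero. *)
Hypothesis yt : 2 * y * t = t ^+ 2 + 1.

Lemma joukowski_neq0 : t != 0.
Proof.
apply/eqP => t0; move/eqP: yt.
by rewrite t0 mulr0 expr0n add0r eq_sym oner_eq0.
Qed.

(* t ^ q is a root of X ^ 2 - 2 y X + 1, whose roots are t and 1/t. *)
Lemma joukowski_expr_fix (q : nat) :
  [pchar K].-nat q -> y ^+ q = y -> t ^+ (q ^ 2) = t.
Proof.
move=> cq yq; have t0 := joukowski_neq0.
have yT : 2 * y * t ^+ q = (t ^+ q) ^+ 2 + 1.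
  rewrite -exprM mulnC exprM -[1 in RHS](expr1n _ q) -exprDn_pchar // -yt.
  by rewrite -!mulrA !mulr_natl !mulr2n exprDn_pchar // exprMn yq.
set T := t ^+ q in yT *.
have : (T - t) * (T * t - 1) = 0.
  have -> : (T - t) * (T * t - 1) = t * (T ^+ 2 + 1) - T * (t ^+ 2 + 1) by ring.
  by rewrite -yT -yt; ring.
rewrite expnS expn1 exprM -/T.
move/eqP; rewrite mulf_eq0 !subr_eq0 => /orP[/eqP Tt|/eqP Tt]; first by rewrite Tt.
apply: (@mulIf _ T); first by apply: expf_neq0.
by rewrite {2}/T -exprMn Tt expr1n mulrC.
Qed.

(** For c = 1 or -1, 2t(y + c) = (t + c)^2. Since 2h + 1 is a power of the characteristic (or 1), (t
    + c)^(2h+2) = (t^(2h+1) + c)(t + c), and subtracting the two cases leaves 2t^(2h+1) + 2t. *)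
Lemma joukowski_diff (h : nat) : [pchar K].-nat h.*2.+1 ->
  2 ^+ h.+1 * ((y + 1) ^+ h.+1 - (y - 1) ^+ h.+1) = 2 * (t ^+ h + (t ^+ h)^-1).
Proof.
move=> ch; have t0 := joukowski_neq0; set g := LHS.
have th0 : t ^+ h != 0 by rewrite expf_neq0.
apply: (@mulIf _ (t ^+ h.+1)); first by rewrite expf_neq0.
have sq c : c ^+ 2 = 1 ->
  2 ^+ h.+1 * t ^+ h.+1 * (y + c) ^+ h.+1 = (t ^+ h.*2.+1 + c ^+ h.*2.+1) * (t + c).
  move=> c1; rewrite -exprMn_comm; last exact: mulrC.
  rewrite -exprMn.
  have -> : 2 * t * (y + c) = (t + c) ^+ 2.
    have -> : 2 * t * (y + c) = 2 * y * t + 2 * t * c by ring.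
    by rewrite yt sqrrD c1; ring.
  by rewrite -exprM mul2n doubleS exprSr exprDn_pchar.
have e1 : g * t ^+ h.+1 = 2 ^+ h.+1 * t ^+ h.+1 * (y + 1) ^+ h.+1
   - 2 ^+ h.+1 * t ^+ h.+1 * (y - 1) ^+ h.+1 by rewrite /g; ring.
rewrite e1 !sq ?expr1n ?sqrrN ?expr1n //.
have -> : (-1 : K) ^+ h.*2.+1 = -1 by rewrite -signr_odd /= odd_double.
by rewrite -addnn !exprS exprD; field; rewrite th0.
Qed.

End Joukowski.

Lemma joukowski_exists (K : closedFieldType) (y : K) :
  exists t, 2 * y * t = t ^+ 2 + 1.
Proof.
have [t] := solve_monicpoly (fun i => if i == 0 then -1 else 2 * y) (isT : 0 < 2)%N.
rewrite !big_ord_recl big_ord0 /= expr0 expr1 => e.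
by exists t; rewrite e; ring.
Qed.

(** As 25 = 1 modulo 8. Hence (5^k - 1)/2 is 2 modulo 4 for odd k. *)
Lemma expn5_odd_mod8 (k : nat) : odd k -> (5 ^ k %% 8 = 5)%N.
Proof.
move=> ok; rewrite -(odd_double_half k) ok add1n expnS -mul2n expnM -modnMmr.
by rewrite -modnXm exp1n.
Qed.

Lemma halfpower_difference_inj (F : finFieldType) (n k h : nat) :
  #|F| = (5 ^ n)%N -> odd k -> coprime k (n * 2) -> (5 ^ k = h.*2.+1)%N ->
  forall y1 y2 : F,
  (y1 + 1) ^+ h.+1 - (y1 - 1) ^+ h.+1 = (y2 + 1) ^+ h.+1 - (y2 - 1) ^+ h.+1 ->
  y1 = y2 \/ y1 = - y2.
Proof.
move=> cF ok ckn hk y1 y2 ey.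
have [K [f _]] := countable_algebraic_closure F.
have c5 : 5%N \in [pchar K] by rewrite (fmorph_pchar f) (card_finPcharP cF).
have pK j : [pchar K].-nat (5 ^ j)%N by rewrite pnatX pnatE // c5.
have two0 : (2 : K) != 0 by rewrite -(dvdn_pcharf c5).
have fq y : f y ^+ (5 ^ n) = f y by rewrite -rmorphXn -cF expf_card.
have [t1 e1] := joukowski_exists (f y1); have [t2 e2] := joukowski_exists (f y2).
have q1 := joukowski_expr_fix e1 (pK n) (fq y1).
have q2 := joukowski_expr_fix e2 (pK n) (fq y2).
have t10 := joukowski_neq0 e1; have t20 := joukowski_neq0 e2.
(* Such an s is fixed by the powers 5^(2n) and 5^k, hence by 5, so s^4 = 1; as h is 2 modulo 4, s^h
   is then s^2. *)
have root1 (s : K) : s != 0 -> s ^+ ((5 ^ n) ^ 2) = s -> s ^+ h = 1 ->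
    s = 1 \/ s = -1.
  move=> s0 sq sh.
  have sk : s ^+ (5 ^ k) = s by rewrite hk exprS -mul2n mulnC exprM sh expr1n mulr1.
  have s5 : s ^+ 5 = s.
    apply: (expr_fix_coprime _ ckn sk); first by case: (k) ok.
    by rewrite expnM.
  have s4 : s ^+ 4 = 1 by apply: (mulfI s0); rewrite -exprS s5 mulr1.
  have h4 : h = (h %/ 4 * 4 + 2)%N by have := expn5_odd_mod8 ok; lia.
  move: sh; rewrite h4 exprD mulnC exprM s4 expr1n mul1r => /eqP.
  by rewrite sqrf_eq1 => /orP[/eqP|/eqP]; [left|right].
have ew : t1 ^+ h + (t1 ^+ h)^-1 = t2 ^+ h + (t2 ^+ h)^-1.
  have pk : [pchar K].-nat h.*2.+1 by rewrite -hk.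
  apply: (mulfI two0); rewrite -(joukowski_diff e1 pk) -(joukowski_diff e2 pk).
  by congr (_ * _); move/(congr1 f): ey; rewrite !(rmorphB, rmorphXn, rmorphD, rmorph1).
have [s [es st]] : exists s, (s = 1 \/ s = -1) /\ (t1 = s * t2 \/ t1 = s * t2^-1).
  case: (addrV_inj _ _ ew) => [||w|w]; try by rewrite expf_neq0.
    exists (t1 / t2); split; last by left; rewrite divfK.
    apply: root1; first by rewrite mulf_neq0 ?invr_eq0.
      by rewrite exprMn exprVn q1 q2.
    by rewrite exprMn exprVn w mulfV // expf_neq0.
  exists (t1 * t2); split; last by right; rewrite mulfK.
  apply: root1; first by rewrite mulf_neq0.
    by rewrite exprMn q1 q2.
  by rewrite exprMn w mulVf // expf_neq0.
have y1E : f y1 = (t1 + t1^-1) / 2.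
  apply: (mulfI two0); apply: (mulIf t10); rewrite e1; field.
  by rewrite two0 t10.
have y2E : f y2 = (t2 + t2^-1) / 2.
  apply: (mulfI two0); apply: (mulIf t20); rewrite e2; field.
  by rewrite two0 t20.
(* (t + 1/t)/2 is unchanged when t is inverted and changes sign with t. *)
have : f y1 = f y2 \/ f y1 = f (- y2).
  rewrite rmorphN y1E y2E.
  case: es st => -> [] ->; rewrite !(mul1r, mulN1r) ?(invrN, invrK);
    [left | left | right | right]; ring.
by case=> /fmorph_inj; [left|right].
Qed.

(** With r = (5^n - 1)/4 and d = 4a + r, the definition of d amounts to 2a(5^m + 1) = 5r + 1. For k
    = m this gives d(h + 1) = 1 + r(h + 6), and 4 divides h + 6. Replacing m by m + n, odd when m is
    even, only adds a multiple of 5^n - 1. *)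
Lemma exponent_inverse (l n : nat) : (2 <= l)%N -> (2 ^ l %| n.+1)%N ->
  let d := ((5 ^ (n + 1) - 1) %/ (5 ^ ((n + 1) %/ 2 ^ l) + 1) %/ 2
            + (5 ^ n - 1) %/ 4)%N in
  odd d /\ exists k h j : nat, [/\ odd k, coprime k (n * 2),
    (5 ^ k = h.*2.+1)%N & (d * h.+1 = 1 + j * (5 ^ n - 1))%N].
Proof.
move=> hl hn; have [dvdA _ _] := exponent_divisions_exact (ltnW hl) hn.
rewrite /= (addn1 n) in dvdA *; set m := (n.+1 %/ 2 ^ l)%N in dvdA *.
have n4 : (4 %| n.+1)%N by apply: dvdn_trans hn; rewrite (dvdn_exp2l 2 hl).
have on : odd n by lia.
have cmn : coprime m n.
  have : (m %| n.+1)%N by rewrite -(divnK hn) dvdn_mulr.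
  by move/coprime_dvdl; apply; exact: coprimeSn.
have q8 := expn5_odd_mod8 on.
have q16 : (5 ^ n.+1 %% 16 = 1)%N.
  by rewrite -(divnK n4) mulnC expnM -modnXm exp1n.
have B4 : (5 ^ m %% 4 = 1)%N by rewrite -modnXm exp1n.
set A := (_ %/ (5 ^ m + 1))%N; have AE : (A * (5 ^ m + 1) = 5 ^ n.+1 - 1)%N.
  exact: divnK.
(* 16 divides 5^(n+1) - 1 because 4 divides n + 1, whereas 5^m + 1 is twice an odd number. *)
have A8 : (8 %| A)%N.
  rewrite -(@Gauss_dvdl 8 A (5 ^ m %/ 4 * 2 + 1)) //; last first.
    by apply: (@coprimeXl 3 2); rewrite coprime2n; lia.
  apply/dvdnP; exists ((5 ^ n.+1) %/ 16)%N.
  move: AE; rewrite [in LHS](divn_eq (5 ^ m) 4) [in RHS](divn_eq (5 ^ n.+1) 16).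
  rewrite B4 q16; move: (5 ^ m %/ 4)%N (5 ^ n.+1 %/ 16)%N => b c; lia.
have [a eA] : exists a, A = (a * 8)%N by exact/dvdnP.
have [r er or] : exists2 r, (5 ^ n = 4 * r + 1)%N & odd r.
  by exists (5 ^ n %/ 4)%N; lia.
have -> : (A %/ 2 + (5 ^ n - 1) %/ 4 = 4 * a + r)%N by lia.
have aE : (2 * a * (5 ^ m + 1) = 5 * r + 1)%N.
  by move: AE; rewrite expnS er eA; lia.
split; first by lia.
have half k : odd k -> exists2 h, (5 ^ k = h.*2.+1)%N & exists c, (h = 4 * c + 2)%N.
  move=> ok; have := expn5_odd_mod8 ok => k8.
  by exists (5 ^ k %/ 2)%N; [lia | exists (5 ^ k %/ 8)%N; lia].
have [om|em] := boolP (odd m).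
  have [h hE [c hc]] := half _ om.
  exists m, h, c.+2; split=> //.
    by rewrite coprimeMr cmn coprimen2.
  by rewrite er; move: aE; rewrite hE hc; lia.
have ok : odd (m + n) by rewrite oddD on (negbTE em).
have [h hE [c hc]] := half _ ok.
exists (m + n)%N, h, (c.+2 + 2 * a * 5 ^ m)%N; split=> //.
  by rewrite coprimeMr coprimen2 ok andbT /coprime gcdnC gcdnDr gcdnC.
have : (2 * a * 5 ^ (m + n) = 2 * a * h.*2.+1)%N by rewrite hE.
move: aE; rewrite expnD er addnK hc; move: (5 ^ m)%N => B; lia.
Qed.

Theorem theorem1p10 (l n : nat) (hl : (2 <= l)%N) (hn0 : (0 < n)%N)
  (hn : (n%:Z = -1 %[mod (2 ^ l)%N%:Z])%Z)
  (F : finFieldType) (hF : #|F| = (5 ^ n)%N) :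
  let d := ((5 ^ (n + 1) - 1) %/ (5 ^ ((n + 1) %/ 2 ^ l) + 1) %/ 2
            + (5 ^ n - 1) %/ 4)%N in
  APN (fun x : F => x ^+ d).
Proof.
have hdvd : (2 ^ l %| n.+1)%N.
  by move/eqP: hn; rewrite eqz_mod_dvd opprK -PoszD addn1.
move=> d; have := exponent_inverse hl hdvd; cbv zeta; rewrite -/d.
move: d => d [od [k [h [j [ok ckn hk dh]]]]].
have d0 : d != 0%N by case: (d) od.
have c5 : 5%N \in [pchar F] by rewrite (card_finPcharP hF).
have two0 : (2 : F) != 0 by rewrite -(dvdn_pcharf c5).
have fK : cancel (fun x : F => x ^+ d) (fun u => u ^+ h.+1).
  move=> x; have [->|x0] := eqVneq x 0; first by rewrite expr0n (negbTE d0) expr0n.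
  have x1 : x ^+ (5 ^ n - 1) = 1.
    apply: (mulfI x0); rewrite -exprS mulr1 subn1 prednK ?expn_gt0 //.
    by rewrite -hF expf_card.
  by rewrite -exprM dh exprD expr1 mulnC exprM x1 expr1n mulr1.
apply/eqP; rewrite eqn_leq; apply/andP; split.
  apply/bigmax_leqP => a a0; apply/bigmax_leqP => b _.
  rewrite /diff_count; set S := finset _.
  have [->|[x0 x0S]] := set_0Vmem S; first by rewrite cards0.
  have b0 : b != 0.
    apply: contraNneq a0 => b0; move: x0S; rewrite inE b0 subr_eq0.
    by move/eqP/(can_inj fK)/eqP; rewrite -subr_eq0 addrAC subrr add0r.
  (* Rescaled midpoint of x^d and (x + a)^d: for x in [S] these two values are (y - 1)b/2 and (y +
     1)b/2, and [g] recovers x from y. *)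
  pose y x := ((x + a) ^+ d + x ^+ d) / b.
  pose g y := ((y - 1) * (b / 2)) ^+ h.+1.
  have yE x : x \in S -> x ^+ d = (y x - 1) * (b / 2) /\
      (x + a) ^+ d = (y x + 1) * (b / 2).
    rewrite inE => /eqP e; rewrite /y -e.
    rewrite -e in b0; split; field; by rewrite b0 two0.
  have gy x : x \in S -> g (y x) = x.
    by move=> /yE[e _]; rewrite /g -e fK.
  have ydiff x : x \in S ->
      ((y x + 1) ^+ h.+1 - (y x - 1) ^+ h.+1) * (b / 2) ^+ h.+1 = a.
    move=> /yE[e1 e2]; rewrite mulrBl -!exprMn -e1 -e2 !fK.
    by rewrite addrAC subrr add0r.
  (* All [y x] with x in [S] give the same difference, so they agree up to sign. *)
  have SS : S \subset [set g (y x0); g (- y x0)].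
    apply/subsetP => x xS; rewrite !inE -{1 2}(gy _ xS).
    have [|->|->] := halfpower_difference_inj hF ok ckn hk (y1 := y x) (y2 := y x0).
    - have bh0 : (b / 2) ^+ h.+1 != 0 by rewrite expf_neq0 // mulf_neq0 ?invr_eq0.
      by apply: (mulIf bh0); rewrite !ydiff.
    - by rewrite eqxx.
    - by rewrite eqxx orbT.
  by apply: leq_trans (subset_leq_card SS) _; rewrite cards2; case: eqP.
(* Since d is odd, 0 and -1 are both solutions for a = b = 1. *)
apply: leq_trans (leq_bigmax_cond 1 _); last exact: oner_neq0.
apply: leq_trans (leq_bigmax 1).
have <- : #|[set (0 : F); -1]| = 2%N by rewrite cards2 eq_sym oppr_eq0 oner_eq0.
apply/subset_leq_card/subsetP => x; rewrite !inE.
case/orP=> /eqP->; first by rewrite add0r expr1n expr0n (negbTE d0) subr0.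
by rewrite addNr expr0n (negbTE d0) -signr_odd od expr1 sub0r opprK.
Qed.
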